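(* Let $X$ be any Calabi-Yau threefold with Gromov-Witten invariants $[\mathrm{GW}]_{\beta,g}$, Gopakumar-Vafa invariants $[\mathrm{GV}]_{\beta,g}$, and sheaf invariants $\Omega_{\beta,n}$ as defined in the context. Put $\check\lambda=\lambda/2\pi$, $t^{\beta,n}:=t^\beta+n\check\lambda$ and $Q^{\beta,n}:=\exp(2\pi i\,t^{\beta,n})$. Then: (1) The generating function of Gromov-Witten invariants, excluding the classical terms and the contributions from constant maps, $$\tilde F_{GW}(\lambda,t)=\sum_{g=0}^\infty\sum_{\beta>0}\lambda^{2g-2}[\mathrm{GW}]_{\beta,g}\,Q^\beta,$$ can be written as $$\tilde F_{GW}(\lambda,t)=\sum_{n\in\mathbb Z}\sum_{\beta>0}\Omega_{\beta,n}\,\tilde F^{con}(\lambda,t^{\beta,n})=\sum_{n\in\mathbb Z}\sum_{\beta>0}\Omega_{\beta,n}\left(\frac{1}{\lambda^2}\mathrm{Li}_3(Q^{\beta,n})+\sum_{g=1}^\infty\lambda^{2g-2}\frac{(-1)^{g-1}B_{2g}}{2g\,(2g-2)!}\mathrm{Li}_{3-2g}(Q^{\beta,n})\right).$$ (2) A similar relation holds for the generating function of Gopakumar-Vafa invariants $$F_{GV}(\lambda,t)=\sum_{\beta>0}\sum_{g\ge0}[\mathrm{GV}]_{\beta,g}\sum_{k\ge1}\frac1k\left(2\sin\frac{k\lambda}{2}\right)^{2g-2}Q^{k\beta},$$ namely $$F_{GV}(\lambda,t)=\sum_{n\in\mathbb Z}\sum_{\beta>0}\Omega_{\beta,n}\sum_{m=1}^\infty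 \log\left(1-Q^\beta e^{i(n+m)\lambda}\right)^m=\sum_{n\in\mathbb Z}\sum_{\beta>0}\Omega_{\beta,n}\,F^{con}_{GV}(\lambda,t^\beta+n\check\lambda).$$
   Context: $\beta$ ranges over curve classes in $H_2(X,\mathbb Z)$ and $\beta>0$ means non-constant classes. $Q^\beta=\exp(2\pi i t^\beta)$ is treated as a formal variable, with $Q^{k\beta}=(Q^\beta)^k$. $B_n$ are the Bernoulli numbers, $\frac{w}{e^w-1}=\sum_{n\ge0}B_n\frac{w^n}{n!}$, and $\mathrm{Li}_s(z)=\sum_{k\ge1}z^k/k^s$. The expression $\log(1-x)^m$ means $\log\big((1-x)^m\big)=m\log(1-x)$. Gopakumar-Vafa invariants: the integers $[\mathrm{GV}]_{\beta,g}$ are such that the asymptotic expansion of $F_{GV}(\lambda,t)$ (as displayed in the claim) at $\lambda=0$ is $\tilde F_{GW}(\lambda,t)$. Standing assumption (finiteness): for each $\beta$ there is $g_\beta$ with $[\mathrm{GV}]_{\beta,g}=0$ for all $g\ge g_\beta$. Sheaf invariants: the integers $\Omega_{\beta,n}$ are defined by $$\sum_{n\in\mathbb Z}\Omega_{\beta,n}y^n=\sum_{g\ge0}[\mathrm{GV}]_{\beta,g}(-1)^g(y^{1/2}-y^{-1/2})^{2g},$$ so for each $\beta$ only finitely many $\Omega_{\beta,n}$ are non-zero. Resolved conifold: with $Q=e^{2\pi i t}$, $$\tilde F^{con}(\lambda,t)=\frac1{\lambda^2}\mathrm{Li}_3(Q)+\sum_{g\ge1}\lambda^{2g-2}\frac{(-1)^{g-1}B_{2g}}{2g(2g-2)!}\mathrm{Li}_{3-2g}(Q),\qquad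 F^{con}_{GV}(\lambda,t)=\sum_{k\ge1}\frac{Q^k}{k\,(2\sin(k\lambda/2))^2}.$$ The right-hand side of (1) is the formal series, asymptotic as $\lambda\to0$, obtained by expanding each summand in $\lambda$ with $t^{\beta,n}$ regarded as a formal variable. *)

(* Defs.v *)
From HB Require Import structures.
From mathcomp Require Import all_boot all_order all_algebra.
From mathcomp Require Import all_classical all_reals all_analysis.
From mathcomp Require Import complex ring.

Set Implicit Arguments.
Unset Strict Implicit.
Unset Printing Implicit Defensive.

Import Order.TTheory GRing.Theory Num.Theory.
Import numFieldNormedType.Exports.

Local Open Scope classical_set_scope.
Local Open Scope ring_scope.

(* Bernoulli numbers: bernoulli_upto n = [:: B_0; ...; B_(n-1)].  The
   recurrence is the one obtained by comparing coefficients in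
   (\sum_n B_n w^n / n!) * ((e^w - 1) / w) = 1; see bernoulli_genE. *)
Fixpoint bernoulli_upto (n : nat) : seq rat :=
  if n is m.+1 then
    let s := bernoulli_upto m in
    rcons s (((m == 0%N)%:R - \sum_(k < m) 'C(m.+1, k)%:R * s`_k) / m.+1%:R)
  else [::].

Definition bernoulli (n : nat) : rat := (bernoulli_upto n.+1)`_n.

Lemma size_bernoulli_upto n : size (bernoulli_upto n) = n.
Proof. by elim: n => //= n IHn; rewrite size_rcons IHn. Qed.

Lemma nth_bernoulli_upto n k : (k < n)%N -> (bernoulli_upto n)`_k = bernoulli k.
Proof.
elim: n => // n IHn; rewrite ltnS leq_eqVlt => /orP[/eqP -> //|ltkn].
by rewrite /= nth_rcons size_bernoulli_upto ltkn IHn.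
Qed.

Lemma bernoulli_genE n :
  \sum_(k < n.+1) bernoulli k / k`!%:R / (n.+1 - k)`!%:R = (n == 0%N)%:R.
Proof.
have fact_neq0 m : m`!%:R != 0 :> rat by rewrite pnatr_eq0 -lt0n fact_gt0.
have binE k : (k <= n.+1)%N ->
    bernoulli k / k`!%:R / (n.+1 - k)`!%:R =
    'C(n.+1, k)%:R * bernoulli k / n.+1`!%:R.
  move=> lekn; rewrite -(bin_fact lekn) !natrM.
  have bin_neq0 : 'C(n.+1, k)%:R != 0 :> rat by rewrite pnatr_eq0 -lt0n bin_gt0.
  by field; rewrite bin_neq0 !fact_neq0.
under eq_bigr => k _ do rewrite binE ?(ltnW (ltn_ord k)) //.
rewrite -mulr_suml big_ord_recr /= binSn.
rewrite {2}/bernoulli /= nth_rcons size_bernoulli_upto ltnn eqxx.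
rewrite [n.+1%:R * _]mulrC divfK ?pnatr_eq0 //.
under [in X in _ - X]eq_bigr => k _ do rewrite nth_bernoulli_upto ?ltn_ord //.
rewrite addrC subrK; case: n {binE} => [|n] /=; last by rewrite mul0r.
by rewrite divr1.
Qed.

Section ComplexFunctions.
Variable R : realType.
Local Notation C := R[i].

Definition cexp (z : C) : C :=
  (expR (complex.Re z) * cos (complex.Im z) +i*
   (expR (complex.Re z) * sin (complex.Im z)))%C.

Definition csin (z : C) : C := (cexp ('i * z) - cexp (- ('i * z))) / (2 * 'i).

(* f ~ \sum_j a_j z^j as z --> 0 with z != 0, the sequence a being zero at all
   sufficiently negative indices. *)
Definition asymptotic0 (f : C -> C) (a : int -> C) :=
  (exists N : int, forall j : int, j < N -> a j = 0) /\
  forall N : int,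
    ((f z - \sum_(j \in [set j : int | j <= N]) a j * z ^ j) / z ^ N : C^o)
      @[z --> (0 : C^o)^'] --> (0 : C^o).

(* \sum_(m >= 1) a_m in the topology of C. *)
Definition psum1 (a : nat -> C) (M : nat) : C := \sum_(1 <= m < M) a m.

Definition summable1 (a : nat -> C) : Prop := cvgn (psum1 a : nat -> C^o).

Definition sum1 (a : nat -> C) : C := limn (psum1 a : nat -> C^o).

End ComplexFunctions.

(* The part of the geometry of the threefold X that is needed to manipulate
   series in the formal variables Q^beta: H stands for H_2(X, Z), curve for the
   monoid of curve classes (0 being the class of constant maps), and area for
   the pairing with a Kaehler class.  Only finitely many curve classes have
   bounded area (Gromov compactness); hence, for a given gamma, there are only
   finitely many pairs (k, beta) with k * beta = gamma, 0 < k, 0 < beta. *)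
Record curveClasses (R : realType) (H : zmodType) := CurveClasses {
  curve : set H;
  curve0 : curve 0;
  curveD : forall b c : H, curve b -> curve c -> curve (b + c);
  area : {additive H -> R};
  area_gt0 : forall b : H, curve b -> b != 0 -> 0 < area b;
  finite_area_le : forall E : R, finite_set [set b : H | curve b /\ area b <= E]
}.

(* The classes beta > 0. *)
Definition posCurve (R : realType) (H : zmodType) (X : curveClasses R H) :
  set H := [set b | curve X b /\ b != 0].

Definition posNat : set nat := [set k | (0 < k)%N].

(* A pair t = (beta, n) : H * int stands for the variable t^{beta,n} =
   t^beta + n lambda / 2 pi, with t^{beta,0} = t^beta, so that t *+ k stands for
   k t^{beta,n} and the exponential of 2 pi i t is Q^beta e^{i n lambda}.

   Such expressions are read in two ways:
   - at a complex number lambda, as formal series in the Q^gamma with complex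
     coefficients, i.e., functions H -> C (the coefficient of Q^gamma);
   - formally in lambda as well, as series in the Q^gamma whose coefficients
     are Laurent series in lambda, i.e., functions H -> int -> C (the
     coefficient of Q^gamma lambda^j).
   Infinite sums of formal series are taken coefficientwise; apart from the sum
   over m of the logarithms, which converges only in the topology of C, all of
   them have finitely many nonzero terms in each coefficient. *)

Section AnalyticSeries.
Variables (R : realType) (H : zmodType).
Local Notation C := R[i].

Definition expQ (lambda : C) (t : H * int) (gamma : H) : C :=
  (gamma == t.1)%:R * cexp ('i * t.2%:~R * lambda).

(* log (1 - x) = - \sum_(k >= 1) x^k / k for x the exponential of 2 pi i t. *)
Definition log1subQ (lambda : C) (t : H * int) (gamma : H) : C :=
  - \sum_(k \in posNat) expQ lambda (t *+ k) gamma / k%:R.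

Definition FconGV (lambda : C) (t : H * int) (gamma : H) : C :=
  \sum_(k \in posNat) expQ lambda (t *+ k) gamma /
    (k%:R * (2 * csin (k%:R * lambda / 2)) ^+ 2).

Definition FGV (X : curveClasses R H) (GV : H -> nat -> int)
    (lambda : C) (gamma : H) : C :=
  \sum_(b \in posCurve X) \sum_(g \in [set: nat]) (GV b g)%:~R *
    \sum_(k \in posNat) k%:R^-1 *
      (2 * csin (k%:R * lambda / 2)) ^ (2 * g%:Z - 2) *
      expQ lambda ((b, 0) *+ k) gamma.

End AnalyticSeries.

Section FormalSeries.
Variables (R : realType) (H : zmodType).
Local Notation C := R[i].

(* Multiplication by lambda^d. *)
Definition lamX (d : int) (f : H -> int -> C) (gamma : H) (j : int) : C :=
  f gamma (j - d).

(* Q^beta e^{i n lambda} = \sum_l Q^beta (i n)^l lambda^l / l!. *)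
Definition expQf (t : H * int) (gamma : H) (j : int) : C :=
  if j is Posz l then
    (gamma == t.1)%:R * (('i * t.2%:~R) ^+ l / l`!%:R)
  else 0.

(* The polylogarithm Li_s at the exponential of 2 pi i t. *)
Definition LiQ (s : int) (t : H * int) (gamma : H) (j : int) : C :=
  \sum_(k \in posNat) expQf (t *+ k) gamma j / k%:R ^ s.

Definition con_coef (g : nat) : C :=
  (-1) ^+ (g - 1) * ratr (bernoulli (2 * g)) /
  ((2 * g)%:R * (2 * g - 2)`!%:R).

Definition Fcon (t : H * int) (gamma : H) (j : int) : C :=
  lamX (- 2) (LiQ 3 t) gamma j +
  \sum_(g \in posNat) con_coef g *
    lamX (2 * g%:Z - 2) (LiQ (3 - 2 * g%:Z) t) gamma j.

Definition FGW (X : curveClasses R H) (GW : H -> nat -> rat)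
    (gamma : H) (j : int) : C :=
  \sum_(g \in [set: nat]) \sum_(b \in posCurve X)
    ratr (GW b g) * lamX (2 * g%:Z - 2) (expQf (b, 0)) gamma j.

End FormalSeries.

Section Invariants.
Variables (R : realType) (H : zmodType) (X : curveClasses R H).
Local Notation C := R[i].

Definition GV_finite (GV : H -> nat -> int) :=
  forall b, posCurve X b ->
    exists g_b : nat, forall g, (g_b <= g)%N -> GV b g = 0.

Definition is_GV (GW : H -> nat -> rat) (GV : H -> nat -> int) :=
  forall gamma : H,
    asymptotic0 (fun lambda => FGV X GV lambda gamma) (FGW X GW gamma).

(* The defining identity of the Omega_{beta,n} is one between Laurent
   polynomials in the variable u = y^{1/2}; it is stated as an equality of
   functions of u in C^*. *)
Definition is_sheaf_inv (GV : H -> nat -> int) (Omega : H -> int -> int) :=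
  forall b, posCurve X b ->
    finite_set [set n | Omega b n != 0] /\
    forall u : C, u != 0 ->
      \sum_(n \in [set: int]) (Omega b n)%:~R * (u ^+ 2) ^ n =
      \sum_(g \in [set: nat])
        (GV b g)%:~R * (-1) ^+ g * (u - u^-1) ^+ (2 * g).

End Invariants.

(* Main.v *)
(** As [gamma = k beta] determines [k] from [beta], each coefficient of [Q^gamma]
    is a finite sum over [beta] and [n] of terms with a single [k].  Putting
    [y = e^(i k lambda)] in the identity that defines the sheaf invariants gives
    [\sum_n Omega_n e^(i n k lambda) = \sum_g GV_g (2 sin (k lambda / 2))^(2g)];
    division by [k (2 sin (k lambda / 2))^2] expresses [F_GV] by the conifold
    functions.  The logarithms come from [\sum_m m q^m = q / (1 - q)^2] at
    [q = e^(i k lambda)].  For Gromov-Witten invariants, asymptotic expansions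
    are unique, so it remains to expand [e^(i n k lambda) / (2 sin (k lambda / 2))^2];
    with [x = i k lambda] its denominator is [- (e^x - 1)^2 / e^x], and
    [x^2 e^x / (e^x - 1)^2 = - x^2 d/dx (1 / (e^x - 1)) = \sum_n (1 - n) B_n x^n / n!]. *)

Require Import Defs.
From HB Require Import structures.
From mathcomp Require Import all_boot all_order all_algebra.
From mathcomp Require Import all_classical all_reals all_analysis.
From mathcomp Require Import complex ring lra zify.
Import Order.TTheory GRing.Theory Num.Theory.
Import numFieldNormedType.Exports.
Local Open Scope classical_set_scope.
Local Open Scope ring_scope.
Set Implicit Arguments.
Unset Strict Implicit.
Unset Printing Implicit Defensive.

(** * Taylor expansion of the complex exponential *)

Section ComplexExponential.
Variable R : realType.
Local Notation C := R[i].
Implicit Types z w : C.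

Lemma cexp0 : cexp (0 : C) = 1.
Proof. by rewrite /cexp /= expR0 cos0 sin0 mulr1 mulr0. Qed.

Lemma cexpD z w : cexp (z + w) = cexp z * cexp w.
Proof.
case: z => a b; case: w => c d; rewrite /cexp /= expRD cosD sinD.
by apply/eqP; rewrite eq_complex /=; apply/andP; split; apply/eqP; ring.
Qed.

Lemma cexp_neq0 z : cexp z != 0.
Proof.
have : cexp z * cexp (- z) != 0 by rewrite -cexpD subrr cexp0 oner_neq0.
by rewrite mulf_eq0 negb_or => /andP[].
Qed.

Lemma cexpN z : cexp (- z) = (cexp z)^-1.
Proof.
by apply: (mulfI (cexp_neq0 z)); rewrite -cexpD subrr cexp0 divff ?cexp_neq0.
Qed.

Lemma cexpMn z n : cexp (z *+ n) = cexp z ^+ n.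
Proof. by elim: n => [|n IHn]; rewrite ?cexp0 // mulrSr cexpD IHn exprSr. Qed.

Lemma cexpMz z (n : int) : cexp (z *~ n) = cexp z ^ n.
Proof.
by case: n => n; rewrite ?NegzE ?mulrNz ?cexpN ?exprN -?pmulrn -?exprnP cexpMn.
Qed.

Lemma norm_cexp z : `|cexp z| = (expR (complex.Re z))%:C%C.
Proof.
case: z => a b; rewrite normc_def /= !exprMn -mulrDr cos2Dsin2 mulr1.
by rewrite sqrtr_sqr ger0_norm ?expR_ge0.
Qed.

Lemma norm_le_ReIm z :
  `|z| <= (`|complex.Re z| + `|complex.Im z|)%:C%C.
Proof.
rewrite {1}(complexE z); apply: le_trans (ler_normD _ _) _.
rewrite normrM rmorphD /= !normc_def /= ?(expr0n, expr1n, addr0, add0r, sqrtr1).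
by rewrite !sqrtr_sqr mul1r.
Qed.

Definition cexp_taylor (N : nat) z : C := \sum_(j < N) z ^+ j / j`!%:R.


Lemma ReB z w : complex.Re (z - w) = complex.Re z - complex.Re w.
Proof. by case: z w => [a b] [c d]. Qed.

Lemma Re_sum n (F : 'I_n -> C) :
  complex.Re (\sum_(i < n) F i) = \sum_(i < n) complex.Re (F i).
Proof. by apply: (big_morph (@complex.Re R)) => // -[a b] [c d]. Qed.

(* For [z] and [w] fixed, [Re (w z^(-N) (cexp (t z) - cexp_taylor N (t z)))] is a
   function of the real variable [t] whose derivative is the same expression at
   [N.-1] and that vanishes at [0] for [N > 0]. *)
Let rem (w z : C) (N : nat) (t : R) : R :=
  complex.Re (w / z ^+ N * cexp (t%:C%C * z)) -
  (\poly_(j < N) (complex.Re (w / z ^+ N * z ^+ j) / j`!%:R)).[t].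

(** Powers of the real number [t] come out of the real part. The polynomial form is the one to
    differentiate; this one exhibits the Taylor remainder. *)
Let remE w z N t : rem w z N t =
  complex.Re (w / z ^+ N * (cexp (t%:C%C * z) - cexp_taylor N (t%:C%C * z))).
Proof.
rewrite /rem mulrBr ReB horner_poly /cexp_taylor mulr_sumr Re_sum.
congr (_ - _); apply: eq_bigr => j _; rewrite exprMn.
have -> : w / z ^+ N * ((t%:C)%C ^+ j * z ^+ j / j`!%:R) =
    (t ^+ j / j`!%:R)%:C%C * (w / z ^+ N * z ^+ j).
  by rewrite rmorphM /= fmorphV /= rmorphXn /= rmorph_nat; ring.
by case: (w / _ * _) => a b /=; rewrite mul0r subr0; ring.
Qed.

Lemma is_derive_Re_cexp (c z : C) (t : R) :
  is_derive t (1 : R) (fun t : R => complex.Re (c * cexp (t%:C%C * z)))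
    (complex.Re (c * z * cexp (t%:C%C * z))).
Proof.
case: c => c d; case: z => a b.
pose la (u : R) : R := u * a; pose lb (u : R) : R := u * b.
have dla : is_derive t (1 : R) la a.
  have -> : la = a \*: id by apply/funext => u; rewrite /la /= mulrC.
  by apply: is_derive_eq; rewrite /GRing.scale /= mulr1.
have dlb : is_derive t (1 : R) lb b.
  have -> : lb = b \*: id by apply/funext => u; rewrite /lb /= mulrC.
  by apply: is_derive_eq; rewrite /GRing.scale /= mulr1.
have -> : (fun u : R => complex.Re ((c +i* d)%C * cexp (u%:C%C * (a +i* b)%C))) =
    (expR \o la) * (c \*: (cos \o lb) - d \*: (sin \o lb)).
  apply/funext => u; rewrite /cexp /= !fctE /= !mul0r subr0 addr0.
  by rewrite /GRing.scale /= /la /lb; ring.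
apply: is_derive_eq.
by rewrite /cexp /= !fctE /= !mul0r subr0 addr0 /GRing.scale /= /la /lb; ring.
Qed.

Let is_derive_rem w z N t : z != 0 ->
  is_derive t (1 : R) (rem w z N.+1) (rem w z N t).
Proof.
move=> z0; rewrite /rem.
have dE := is_derive_Re_cexp (w / z ^+ N.+1) z t.
have shiftE u : w / z ^+ N.+1 * (z * u) = w / z ^+ N * u.
  by rewrite exprS; field; rewrite z0 expf_neq0.
apply: is_derive_eq.
congr (_ - _); first by rewrite -(shiftE (cexp _)) mulrA.
congr (horner _ t); apply/polyP => j.
rewrite coef_deriv !coef_poly ltnS; case: ifP => _; last by rewrite mul0rn.
rewrite [z ^+ j.+1]exprS shiftE factS natrM -mulr_natr.
have j0 : j.+1%:R != 0 :> R by rewrite pnatr_eq0.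
have jf0 : j`!%:R != 0 :> R by rewrite pnatr_eq0 -lt0n fact_gt0.
by field; rewrite jf0 nat1r j0.
Qed.

(** By induction on [N], the mean value theorem bounds [rem w z N] on [[0, 1]] by [e] for [|w| <= 1]
    and [0 < |z| <= 1]. At [t = 1], the choices [w = 1] and [w = - i] give the real and imaginary
    parts of the remainder divided by [z^N]. *)
Lemma cexp_taylorP N : exists2 M : C, 0 <= M &
  forall z, `|z| <= 1 -> `|cexp z - cexp_taylor N z| <= M * `|z| ^+ N.
Proof.
pose e : R := expR 1.
have rem_le w z : `|w| <= 1 -> `|z| <= 1 -> z != 0 ->
    forall t, t \in `[0, 1]%R -> `|rem w z N t| <= e.
  move=> w1 z1 z0; elim: N => [|n IHn] t.
    rewrite in_itv /= => /andP[t0 t1].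
    rewrite remE expr0 divr1 /cexp_taylor big_ord0 subr0.
    rewrite -lecR; apply: le_trans (normc_ge_Re _) _.
    rewrite normrM norm_cexp -[leRHS]mul1r; apply: ler_pM => //.
      by rewrite ler0c expR_ge0.
    rewrite lecR ler_expR.
    have : complex.Re z <= 1.
      rewrite -lecR; apply: le_trans z1; apply: le_trans (normc_ge_Re z).
      by rewrite lecR ler_norm.
    by case: (z) => a b /=; rewrite mul0r subr0 => a1; nra.
  move=> /[dup] tI; rewrite in_itv /= => /andP[t0 t1].
  have r0 : rem w z n.+1 0 = 0.
    rewrite remE mul0r cexp0 /cexp_taylor big_ord_recl big1 ?addr0 => [|i _].
      by rewrite expr0 divr1 subrr mulr0.
    by rewrite lift0 expr0n mul0r.
  have [|||c] := @MVT_segment _ (rem w z n.+1) (rem w z n) 0 t.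
  - by [].
  - by move=> x _; exact: is_derive_rem.
  - apply: continuous_subspaceT => x; apply: differentiable_continuous.
    by apply/derivable1_diffP; case: (is_derive_rem w n x z0).
  rewrite in_itv /= => /andP[c0 ct]; rewrite r0 !subr0 => ->.
  rewrite normrM (ger0_norm t0) -[leRHS]mulr1.
  apply: ler_pM => //; apply: IHn; rewrite in_itv /= c0.
  exact: le_trans ct t1.
(* [e + e] bounds the two parts; the summand 1 covers [z = 0], [N = 0], where the remainder is
   [cexp 0 = 1]. *)
exists (1 + (e + e)%:C%C).
  by rewrite addr_ge0 // ler0c addr_ge0 // expR_ge0.
move=> z z1; have [->|z0] := eqVneq z 0.
  case: N {rem_le} => [|n].
    rewrite /cexp_taylor big_ord0 cexp0 subr0 expr0 mulr1 normr1 lerDl ler0c.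
    by rewrite addr_ge0 // expR_ge0.
  rewrite /cexp_taylor big_ord_recl big1 => [|i _].
    by rewrite cexp0 expr0 divr1 addr0 subrr !normr0 expr0n mulr0.
  by rewrite lift0 expr0n mul0r.
rewrite -ler_pdivrMr ?exprn_gt0 ?normr_gt0 // -normrX -normf_div.
set u := _ / _.
have u1 : rem 1 z N 1 = complex.Re u.
  by rewrite remE mul1r mul1r mulrC.
have u2 : rem (- 'i%C) z N 1 = complex.Im u.
  rewrite remE mul1r -/u.
  have -> : - 'i%C / z ^+ N * (cexp z - cexp_taylor N z) = - 'i%C * u by rewrite /u; ring.
  by case: (u) => a b /=; rewrite oppr0 mul0r mulN1r opprK add0r.
apply: le_trans (norm_le_ReIm _) _; rewrite -u1 -u2.
rewrite -[leLHS]add0r; apply: lerD => //; rewrite lecR; apply: lerD; apply: rem_le => //.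
- by rewrite normr1.
- by rewrite in_itv /= ler01 lexx.
- by rewrite normrN normc_def /= expr0n expr1n add0r sqrtr1.
- by rewrite in_itv /= ler01 lexx.
Qed.

End ComplexExponential.

(** * Asymptotic bounds at the origin *)

Section BigO.
Variable K : numFieldType.
Implicit Types (f g : K -> K) (M N : nat) (c z : K) (p q : {poly K}).

(** The neighbourhood is punctured because the quotients to be compared have denominators vanishing
    at the origin. *)
Definition isO N f := exists2 c : K, 0 <= c &
  \forall z \near (0 : K^o)^', `|f z| <= c * `|z| ^+ N.

Lemma near0_le (e : K) : 0 < e -> \forall z \near (0 : K^o)^', `|z| <= e.
Proof.
move=> e0; apply: nbhs_dnbhs; apply/nbhs_normP; exists e => //= z.
by rewrite /= sub0r normrN => /ltW.
Qed.

Lemma near0_neq : \forall z \near (0 : K^o)^', z != 0.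
Proof. exact: nbhs_dnbhs_neq. Qed.

Lemma isO_near_eq N f g :
  (\forall z \near (0 : K^o)^', f z = g z) -> isO N f -> isO N g.
Proof.
move=> fg [c c0 fc]; exists c => //; near=> z.
have -> : g z = f z by apply/esym; near: z.
by near: z.
Unshelve. all: by end_near. Qed.

Lemma isO_eq N f g : f =1 g -> isO N f -> isO N g.
Proof. by move=> /funext ->. Qed.

Lemma isO_add N f g : isO N f -> isO N g -> isO N (fun z => f z + g z).
Proof.
move=> [c c0 fc] [d d0 gd]; exists (c + d); first exact: addr_ge0.
near=> z; apply: le_trans (ler_normD _ _) _; rewrite mulrDl.
by apply: lerD; near: z.
Unshelve. all: by end_near. Qed.

Lemma isO_mul M N f g : isO M f -> isO N g -> isO (M + N) (fun z => f z * g z).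
Proof.
move=> [c c0 fc] [d d0 gd]; exists (c * d); first exact: mulr_ge0.
near=> z; rewrite normrM exprD mulrACA.
by apply: ler_pM => //; near: z.
Unshelve. all: by end_near. Qed.

Lemma isO_cst c : isO 0 (fun=> c).
Proof. by exists `|c| => //; apply: nearW => z; rewrite expr0 mulr1. Qed.

Lemma isO_id : isO 1 id.
Proof. by exists 1 => //; apply: nearW => z; rewrite expr1 mul1r. Qed.

Lemma isO_exp N : isO N (fun z => z ^+ N).
Proof. by exists 1 => //; apply: nearW => z; rewrite normrX mul1r. Qed.

Lemma isO_leq M N f : (M <= N)%N -> isO N f -> isO M f.
Proof.
move=> MN [c c0 fc]; exists c => //; near=> z.
have fz : `|f z| <= c * `|z| ^+ N by near: z.
apply: le_trans fz _; apply: ler_wpM2l => //; apply: ler_wiXn2l => //.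
by near: z; exact: near0_le.
Unshelve. all: by end_near. Qed.

Lemma isO_mull M N f g : isO M f -> isO N g -> isO N (fun z => f z * g z).
Proof. by move=> fM gN; apply: isO_leq (leq_addl M N) (isO_mul fM gN). Qed.

Lemma isO_cstM N c f : isO N f -> isO N (fun z => c * f z).
Proof. by move=> fN; apply: isO_mull fN; exact: isO_cst. Qed.

Lemma isO_opp N f : isO N f -> isO N (fun z => - f z).
Proof. by move=> /(isO_cstM (-1)); apply: isO_eq => z; rewrite mulN1r. Qed.

Lemma isO_sub N f g : isO N f -> isO N g -> isO N (fun z => f z - g z).
Proof. by move=> fN gN; apply: isO_add fN (isO_opp gN). Qed.

Lemma isO_zero N : isO N (fun=> 0).
Proof. by exists 0 => //; apply: nearW => z; rewrite normr0 mul0r. Qed.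

Lemma isO_sum (I : Type) (r : seq I) (P : pred I) N (F : I -> K -> K) :
  (forall i, P i -> isO N (F i)) -> isO N (fun z => \sum_(i <- r | P i) F i z).
Proof.
move=> FN; elim: r => [|i r IHr].
  by apply: isO_eq (isO_zero N) => z; rewrite big_nil.
case: (boolP (P i)) => Pi; last by apply: isO_eq IHr => z; rewrite big_cons (negbTE Pi).
by apply: isO_eq (isO_add (FN i Pi) IHr) => z; rewrite big_cons Pi.
Qed.

Lemma isO_horner p : isO 0 (horner p).
Proof.
elim/poly_ind: p => [|p c IHp].
  by apply: isO_eq (isO_zero 0) => z; rewrite horner0.
apply: isO_eq (isO_add (isO_leq (leq0n _) (isO_mul IHp isO_id)) (isO_cst c)) => z.
by rewrite !hornerE.
Qed.

Lemma near0_scale c (P : K -> Prop) : c != 0 ->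
  (\forall z \near (0 : K^o)^', P z) -> \forall z \near (0 : K^o)^', P (c * z).
Proof.
move=> c0 Pz.
have cvgc : (fun z : K^o => c * z : K^o) @ (0 : K^o)^' --> (0 : K^o)^'.
  move=> A [e /= e0 eA]; exists (e / `|c|); first by rewrite /= divr_gt0 ?normr_gt0.
  move=> z /= ze z0; apply: eA; last by rewrite mulf_neq0.
  move: ze; rewrite /= !sub0r !normrN normrM => ze.
  by rewrite mulrC -ltr_pdivlMr ?normr_gt0.
exact: (cvgc _ Pz).
Qed.

Lemma isO_comp_scale N c f : c != 0 -> isO N f -> isO N (fun z => f (c * z)).
Proof.
move=> c0 [d d0 fd]; exists (d * `|c| ^+ N); first by rewrite mulr_ge0 ?exprn_ge0.
apply: filterS (near0_scale c0 fd) => z.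
by rewrite normrM exprMn mulrA.
Qed.

Lemma isO_divX N f : isO N.+1 (fun z => f z * z) -> isO N f.
Proof.
move=> [c c0 fc]; exists c => //; near=> z.
have z0 : z != 0 by near: z; exact: near0_neq.
have : `|f z * z| <= c * `|z| ^+ N.+1 by near: z.
by rewrite normrM exprSr mulrA ler_pM2r // normr_gt0.
Unshelve. all: by end_near. Qed.

Lemma isO_divXn M N f : isO (N + M) (fun z => f z * z ^+ M) -> isO N f.
Proof.
elim: M => [|M IHM]; first by rewrite addn0; apply: isO_eq => z; rewrite mulr1.
rewrite addnS => fO; apply: IHM; apply: isO_divX; apply: isO_eq fO => z.
by rewrite exprSr mulrA.
Qed.

Lemma isO_cst_eq0 c : isO 1 (fun=> c) -> c = 0.
Proof.
move=> [d d0 cd]; apply/eqP/negPn/negP => c0.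
(* At a point with [|z| <= |c| / (2 d + 1)] the bound [|c| <= d |z|] gives [2 d + 1 <= d], absurd
   for [d >= 0]. *)
have e0 : 0 < `|c| / (d + d + 1).
  by rewrite divr_gt0 ?normr_gt0 // ltr_wpDl // addr_ge0.
have [z [zc zle]] := filter_ex (filterI cd (near0_le e0)).
have dd : 0 < d + d + 1 by rewrite ltr_wpDl // addr_ge0.
have := le_trans zc (ler_wpM2l d0 zle).
rewrite mulrCA -[leLHS]mulr1 ler_pM2l ?normr_gt0 // ler_pdivlMr // mul1r.
by rewrite -addrA gerDl => /(lt_le_trans (ltr_wpDl d0 ltr01)); rewrite ltxx.
Qed.

Lemma isO_cvg0 f : isO 1 f -> (f z : K^o) @[z --> (0 : K^o)^'] --> (0 : K^o).
Proof.
move=> [c c0 fc]; have c1 : 0 < c + 1 by rewrite ltr_wpDl.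
apply/cvgr0Pnorm_le => e e0; near=> z.
have fz : `|f z| <= c * `|z| ^+ 1 by near: z.
apply: le_trans fz _; rewrite expr1.
have ze : `|z| <= e / (c + 1) by near: z; apply: near0_le; rewrite divr_gt0.
have -> : e = (c + 1) * (e / (c + 1)) by rewrite mulrC divfK ?gt_eqF.
by apply: ler_pM => //; rewrite lerDl.
Unshelve. all: by end_near. Qed.

(** The constant coefficient is itself [O(z)], hence zero; then divide by [z] and induct. *)
Lemma coef_isO N p i : isO N (horner p) -> (i < N)%N -> p`_i = 0.
Proof.
elim: N p i => // N IHN p i; elim/poly_ind: p => [|p c _] pN iN.
  by rewrite coef0.
have c0 : c = 0.
  apply: isO_cst_eq0.
  have := isO_sub (isO_leq (ltn0Sn N) pN) (isO_mul (isO_horner p) isO_id).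
  by apply: isO_eq => z; rewrite !hornerE addrC addKr.
rewrite c0 addr0 coefMX; case: i iN => //= i; rewrite ltnS; apply: IHN.
by apply: isO_divX; apply: isO_eq pN => z; rewrite !hornerE c0 addr0.
Qed.

(** Near the origin [|f z - c| <= |c| / 2], so [|f z| >= |c| / 2]. *)
Lemma isO_inv f c : c != 0 -> isO 1 (fun z => f z - c) ->
  (\forall z \near (0 : K^o)^', f z != 0) /\ isO 0 (fun z => (f z)^-1).
Proof.
move=> c0 [d d0 fd]; have cgt0 : 0 < `|c| by rewrite normr_gt0.
have d1 : 0 < d *+ 2 + 1 by rewrite ltr_wpDl // mulrn_wge0.
have H : \forall z \near (0 : K^o)^', `|c| <= `|f z| * 2.
  near=> z.
  have fz : `|f z - c| <= d * `|z| ^+ 1 by near: z.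
  have zc : `|z| <= `|c| / (d *+ 2 + 1) by near: z; apply: near0_le; rewrite divr_gt0.
  have h : `|f z - c| *+ 2 <= `|c|.
    have -> : `|c| = (d *+ 2 + 1) * (`|c| / (d *+ 2 + 1)).
      by rewrite mulrC divfK ?gt_eqF.
    rewrite -mulr_natr; apply: le_trans (ler_wpM2r _ fz) _ => //.
    by rewrite expr1 mulrAC mulr_natr; apply: ler_pM; rewrite ?mulrn_wge0 // lerDl.
  have : `|c| <= `|f z| + `|f z - c|.
    by rewrite -{1}(subKr (f z) c); apply: ler_normB.
  move=> h1; rewrite -(lerD2r `|c|) -mulr2n -(mulr_natr `|c|).
  apply: le_trans (ler_wpM2r (ler0n _ 2) h1) _.
  by rewrite mulrDl lerD2l mulr_natr.
split.
  by apply: filterS H => z; apply: contraTneq => ->; rewrite normr0 mul0r lt_geF.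
exists (2 / `|c|); first by rewrite divr_ge0.
apply: filterS H => z fz; rewrite expr0 mulr1 normfV.
have f0 : 0 < `|f z|.
  by have := lt_le_trans cgt0 fz; rewrite pmulr_lgt0.
by rewrite ler_pdivlMr // mulrC ler_pdivrMr // mulrC.
Unshelve. all: by end_near. Qed.

End BigO.

(** * Bernoulli numbers *)

Section BernoulliPolynomials.
Variable K : numFieldType.
Implicit Types (c : K) (p q r : {poly K}).

Definition exp_poly N c : {poly K} := \poly_(j < N) (c ^+ j / j`!%:R).

(** The truncation of [w / (e^w - 1)], with [B_1 = - 1/2]. *)
Definition bern_poly N : {poly K} := \poly_(j < N) (ratr (bernoulli j) / j`!%:R).

(* The truncation of [- w^2 d/dw (1 / (e^w - 1)) = w^2 e^w / (e^w - 1)^2]. *)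
Definition dbern_poly N : {poly K} :=
  \poly_(j < N) ((1 - j%:R) * ratr (bernoulli j) / j`!%:R).

Lemma fact_neq0 n : n`!%:R != 0 :> K.
Proof. by rewrite pnatr_eq0 -lt0n fact_gt0. Qed.

Lemma coef_lt0_factor p N : (forall i, (i < N)%N -> p`_i = 0) ->
  exists r, p = r * 'X^N.
Proof.
move=> p0; exists (drop_poly N p); rewrite -{1}(poly_take_drop N p).
suff -> : take_poly N p = 0 by rewrite add0r.
by apply/polyP => i; rewrite coef_take_poly coef0; case: ifP => // /p0.
Qed.

Lemma exp_polyB1 N : exists r, exp_poly N.+1 1 - 1 = r * 'X.
Proof.
have [i|r e] := @coef_lt0_factor (exp_poly N.+1 1 - 1) 1; last by exists r.
by rewrite ltnS leqn0 => /eqP ->; rewrite coefB coef_poly coef1 /= expr0 divr1 subrr.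
Qed.

Lemma deriv_exp_poly N : (exp_poly N.+1 1)^`() = exp_poly N.+1 1 - (N`!%:R^-1)%:P * 'X^N.
Proof.
apply/polyP => j; rewrite coef_deriv coefB coefCM coefXn !coef_poly ltnS !expr1n !mul1r.
have f0 := fact_neq0 j; have j0 : j.+1%:R != 0 :> K by rewrite pnatr_eq0.
rewrite [(j < N.+1)%N]ltnS; case: (ltngtP j N) => [_|_|<-].
- rewrite mulr0 subr0 factS natrM -mulr_natr.
  by field; rewrite f0 nat1r j0.
- by rewrite mulr0 subr0 mul0rn.
- by rewrite mulr1 subrr mul0rn.
Qed.

(** Coefficientwise this is [bernoulli_genE]. Cutting the Bernoulli series before degree [N] leaves
    the product exact through degree [N], as [e^w - 1] has no constant term. *)
Lemma bern_polyM_exp N : exists r,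
  bern_poly N * (exp_poly N.+1 1 - 1) = 'X + r * 'X^(N.+1).
Proof.
have e0 : (exp_poly N.+1 1 - 1)`_0 = 0.
  by rewrite coefB coef_poly coef1 /= expr0 divr1 subrr.
have [|r e] := @coef_lt0_factor (bern_poly N * (exp_poly N.+1 1 - 1) - 'X) N.+1.
  move=> [|k] kN; rewrite coefB coefX.
    by rewrite coefM big_ord1 /= e0 mulr0 subrr.
  rewrite coefM big_ord_recr /= subnn e0 mulr0 addr0.
  have -> : \sum_(i < k.+1) (bern_poly N)`_i * (exp_poly N.+1 1 - 1)`_(k.+1 - i) =
     ratr (\sum_(i < k.+1) bernoulli i / i`!%:R / (k.+1 - i)`!%:R).
    rewrite rmorph_sum /=; apply: eq_bigr => i _.
    have iN : (i < N)%N by have := ltn_ord i; lia.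
    have kiN : (k.+1 - i < N.+1)%N by lia.
    have ki0 : (k.+1 - i == 0)%N = false by have := ltn_ord i; lia.
    rewrite coefB !coef_poly coef1 iN kiN ki0.
    by rewrite expr1n mul1r subr0 !rmorphM /= !fmorphV /= !rmorph_nat.
  by rewrite bernoulli_genE rmorph_nat eqSS subrr.
by exists r; rewrite -e; ring.
Qed.

(** This is [- w^2 (b / w)' = b - w b'] for [b = w / (e^w - 1)]. *)
Lemma dbern_polyE N : dbern_poly N = bern_poly N - 'X * (bern_poly N)^`().
Proof.
apply/polyP => j; rewrite coefB coefXM coef_deriv !coef_poly.
case: j => [|j] /=; first by case: ifP => _; rewrite ?subr0 ?mul1r.
by case: ifP => _; rewrite ?mul0rn ?subrr // mulrBl mul1r mulrBl -mulrA mulr_natl.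
Qed.

(* Differentiating [bern * (exp - 1) = X] gives [X bern' (exp - 1) = X - X bern exp]. *)
Lemma dbern_polyM_exp N : exists r,
  dbern_poly N * (exp_poly N.+1 1 - 1) ^+ 2 = 'X^2 * exp_poly N.+1 1 + r * 'X^(N.+2).
Proof.
have [r Br] := bern_polyM_exp N; have [s es] := exp_polyB1 N.
rewrite dbern_polyE; move: Br es (deriv_exp_poly N).
set B := bern_poly N; set e := exp_poly _ 1; set c := _%:R^-1 => Br es de.
have : (B * (e - 1))^`() = ('X + r * 'X^(N.+1))^`() by rewrite Br.
rewrite derivM derivB de derivC subr0 derivD derivX derivM derivXn.
rewrite /= -mulr_natr => dBr.
(* [t] gathers the errors of order [X^N]: the derivative of [r X^(N+1)], and the top term lost in
   differentiating the truncated exponential. *)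
pose t := r^`() * 'X + r * N.+1%:R + B * c%:P.
have dB : B^`() * (e - 1) = 1 - B * e + t * 'X^N.
  rewrite /t !mulrDl; move: dBr; rewrite exprS => /(canRL (addrK _)) ->.
  by ring.
(* The second factor [e - 1 = s X] raises the order of the error [(r - t) X^(N+1)] by one. *)
exists (r * e + (r - t) * s).
rewrite expr2 mulrA mulrBl Br -mulrA dB.
have -> : 'X + r * 'X^(N.+1) - 'X * (1 - B * e + t * 'X^N) =
    'X * e * B + (r - t) * 'X^(N.+1) by rewrite exprS; ring.
rewrite mulrDl -mulrA Br es !exprS; ring.
Qed.

Lemma horner_sub_coefs p N :
  isO N (fun z => p.[z] - \sum_(m < N) p`_m * z ^+ m).
Proof.
apply: isO_eq (isO_mull (isO_horner (drop_poly N p)) (isO_exp K N)) => z.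
have takeE : take_poly N p = \poly_(m < N) p`_m by [].
rewrite -{2}(poly_take_drop N p) hornerD hornerM hornerXn takeE horner_poly.
by rewrite addrAC subrr add0r.
Qed.

End BernoulliPolynomials.

(** * Analytic form of the Bernoulli expansion *)

Section BernoulliExpansion.
Variable R : realType.
Local Notation C := R[i].
Implicit Types c z : C.

Lemma horner_exp_poly N c z : (exp_poly N c).[z] = cexp_taylor N (c * z).
Proof.
by rewrite horner_poly; apply: eq_bigr => j _; rewrite exprMn; ring.
Qed.

Lemma cexp_isO N c : isO N (fun z => cexp (c * z) - (exp_poly N c).[z]).
Proof.
have [M M0 HM] := cexp_taylorP R N.
exists (M * `|c| ^+ N); first by rewrite mulr_ge0 ?exprn_ge0.
have c1 : 0 < `|c| + 1 by rewrite ltr_wpDl.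
(* This radius ensures [|c z| <= 1], also when [c = 0]. *)
have e0 : 0 < (`|c| + 1)^-1 by rewrite invr_gt0.
apply: filterS (near0_le e0) => z ze.
rewrite horner_exp_poly -mulrA -exprMn -normrM; apply: HM.
rewrite normrM; apply: le_trans (ler_wpM2l _ ze) _ => //.
by rewrite ler_pdivrMr // mul1r lerDl.
Qed.

(** Since [e^z - 1 = z + O(z^2)], the quotient [(e^z - 1) / z] is [1 + O(z)] and can be inverted by
    [isO_inv]. *)
Lemma expm1_div :
  (\forall z \near (0 : C^o)^', cexp z - 1 != 0) /\
  isO 0 (fun z : C => z / (cexp z - 1)).
Proof.
have [|nz inv] := @isO_inv _ (fun z => (cexp z - 1) / z) 1 (oner_neq0 _).
  apply: isO_divX; have := cexp_isO 2 1; apply: isO_near_eq.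
  near=> z; have z0 : z != 0 by near: z; exact: near0_neq.
  rewrite horner_exp_poly /cexp_taylor !big_ord_recr big_ord0 /= mul1r.
  by rewrite add0r expr0 expr1 !divr1; field.
split; first by apply: filterS nz => z; rewrite mulf_eq0 negb_or => /andP[].
by apply: isO_eq inv => z; rewrite invf_div.
Unshelve. all: by end_near. Qed.

(** After multiplication by [(e^z - 1)^2] this is the polynomial identity [dbern_polyM_exp] up to
    [O(z^(N+2))]; the division then costs two orders. *)
Lemma dbern_isO N :
  isO N (fun z : C => (dbern_poly _ N).[z] - z ^+ 2 * cexp z / (cexp z - 1) ^+ 2).
Proof.
have [nz inv] := expm1_div.
have [r Er] := dbern_polyM_exp R[i] N.
have dE : isO N.+1 (fun z : C => cexp z - (exp_poly N.+1 1).[z]).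
  by apply: isO_eq (cexp_isO N.+1 1) => z; rewrite mul1r.
pose D z := cexp z - (exp_poly N.+1 1).[z]; pose B := dbern_poly R[i] N.
pose e z : C := cexp z - 1.
have e1 : isO 1 e.
  have := isO_leq (ltn0Sn N) dE; have [s es] := exp_polyB1 R[i] N.
  move=> /isO_add/(_ (isO_mul (isO_horner s) (isO_id _))); apply: isO_eq => z.
  have := congr1 (horner ^~ z) es; rewrite /= hornerMX hornerD hornerN hornerC => <-.
  by rewrite /e; ring.
have num : isO N.+2 (fun z => B.[z] * e z ^+ 2 - z ^+ 2 * cexp z).
  (* With [p = e - D] the value of the truncated [e^z - 1], one has [e^2 - p^2 = D (2 e - D)], of
     order [(N + 1) + 1]. *)
  have t1 : isO N.+2 (fun z => D z * (B.[z] * (e z *+ 2 - D z))).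
    have h : isO 1 (fun z => e z *+ 2 - D z).
      apply: isO_sub (isO_leq (ltn0Sn N) dE).
      by apply: isO_eq (isO_add e1 e1) => z; rewrite mulr2n.
    by have := isO_mul dE (isO_mull (isO_horner B) h); rewrite addn1.
  have t2 : isO N.+2 (fun z => z ^+ 2 * D z).
    by apply: isO_leq (isO_mul (isO_exp R[i] 2) dE); rewrite add2n.
  have t3 := isO_mul (isO_horner r) (isO_exp R[i] N.+2).
  have := isO_add t3 (isO_sub t1 t2); apply: isO_eq => z.
  have := congr1 (horner ^~ z) Er.
  rewrite /= !(hornerXn, horner_exp, hornerD, hornerN, hornerC, hornerM, hornerX) => Erz.
  rewrite /e /D.
  have -> : r.[z] * z ^+ N.+2 =
      (dbern_poly _ N).[z] * ((exp_poly N.+1 1).[z] - 1) ^+ 2 -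
      z ^+ 2 * (exp_poly N.+1 1).[z].
    by rewrite Erz; ring.
  by rewrite /B; ring.
apply: (@isO_divXn _ 2); rewrite addn2.
have := isO_mull (isO_mul inv inv) num; apply: isO_near_eq.
apply: filterS nz => z nz; rewrite -/(e z) in nz *.
by field.
Unshelve. all: by end_near. Qed.

(** The function [z^2 e^z / (e^z - 1)^2] is even, so the polynomial minus its reflection is
    [O(z^N)]; the odd coefficients of this difference are twice those of [dbern_poly]. *)
Lemma coef_dbern_poly_odd N j : odd j -> (j < N)%N -> (dbern_poly R[i] N)`_j = 0.
Proof.
move=> oj jN; set B := dbern_poly _ N.
pose p := B - \poly_(i < N) ((-1) ^+ i * B`_i).
have pN : isO N (horner p).
  have N1 : -1 != 0 :> C by rewrite oppr_eq0 oner_eq0.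
  have := isO_sub (dbern_isO N) (isO_comp_scale N1 (dbern_isO N)).
  apply: isO_near_eq; have [nz _] := expm1_div; apply: filterS nz => z nz.
  have BN : B.[-1 * z] = (\poly_(i < N) ((-1) ^+ i * B`_i)).[z].
    rewrite /B !horner_poly; apply: eq_bigr => i _.
    by rewrite exprMn coef_poly ltn_ord; ring.
  rewrite BN /p hornerD hornerN mulN1r cexpN sqrrN.
  have e0 := cexp_neq0 z.
  have nz' : 1 - cexp z != 0 by rewrite -oppr_eq0 opprB.
  by field; rewrite nz e0 mulN1r nz'.
have := coef_isO pN jN; rewrite /p coefB [X in _ - X]coef_poly jN -signr_odd oj expr1 mulN1r opprK.
by move/eqP; rewrite -mulr2n mulrn_eq0 => /eqP.
Qed.

(** The coefficient [(1 - j) B_j / j!] vanishes for odd [j], and [1 - j] is nonzero for [j > 1]. *)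
Lemma bernoulli_odd j : odd j -> (1 < j)%N -> bernoulli j = 0.
Proof.
move=> oj j1; have := coef_dbern_poly_odd oj (ltnSn j); rewrite coef_poly ltnSn.
move/eqP; rewrite mulf_eq0 invr_eq0 (negbTE (fact_neq0 R[i] _)) orbF mulf_eq0.
rewrite subr_eq0 eq_sym pnatr_eq1 gtn_eqF //= fmorph_eq0.
by move=> /eqP.
Qed.

Lemma sum_double (V : nmodType) (F : nat -> V) N :
  \sum_(j < N.*2) F j = \sum_(g < N) (F g.*2 + F g.*2.+1).
Proof.
elim: N => [|N IHN]; first by rewrite !big_ord0.
by rewrite doubleS !big_ord_recr /= IHN addrA.
Qed.

Definition dbern_coef (g : nat) : C :=
  (1 - (2 * g)%:R) * ratr (bernoulli (2 * g)) / (2 * g)`!%:R.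

Lemma dbern_even_isO N : isO N (fun z : C =>
  \sum_(g < N) dbern_coef g * z ^+ (2 * g) - z ^+ 2 * cexp z / (cexp z - 1) ^+ 2).
Proof.
have /isO_leq := dbern_isO N.*2; move=> /(_ N) H.
apply: isO_eq (H _) => [z|]; last by rewrite -addnn leq_addr.
pose F (j : nat) : C := (1 - j%:R) * ratr (bernoulli j) / j`!%:R * z ^+ j.
rewrite horner_poly (sum_double F N); congr (_ - _).
apply: eq_bigr => g _; rewrite /F /dbern_coef !mul2n.
(* In degree 1 it is the factor [1 - j] that vanishes, [B_1] being nonzero; in higher odd degrees it
   is the Bernoulli number. *)
have [->|g0] := posnP g.
  by rewrite subrr !mul0r addr0.
by rewrite (@bernoulli_odd g.*2.+1) /= ?odd_double // ?rmorph0 ?mulr0 ?mul0r ?addr0 //; lia.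
Qed.
End BernoulliExpansion.

(** * Asymptotic expansions and the resolved conifold *)

Section Asymptotics.
Variable R : realType.
Local Notation C := R[i].
Implicit Types (a : int -> C) (f : C -> C).

(** The index set is infinite; vanishing below [L] makes the support finite, so that the sum does
    not fall back to its default value. *)
Lemma sum_le_int (L : int) n a : (forall j, j < L -> a j = 0) ->
  \sum_(j \in [set j : int | j <= L + n%:Z]) a j = \sum_(i < n.+1) a (L + i%:Z).
Proof.
move=> aL; rewrite (@fsbigE _ _ _ _ _ [seq L + i%:Z | i <- index_iota 0 n.+1]).
- rewrite big_map big_mkord.
  by apply: eq_bigl => i; rewrite mem_set //=; have := ltn_ord i; lia.
- by rewrite map_inj_uniq ?iota_uniq // => i j; lia.
- move=> j jr; have /mapP[m] : j \in [seq L + i%:Z | i <- index_iota 0 n.+1] := jr.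
  by rewrite mem_index_iota => /andP[_ ?] ->; rewrite /mkset; lia.
move=> j jn jr; have {}jn : j <= L + n%:Z := jn; apply: aL; rewrite ltNge; apply/negP => Lj.
move/negP: jr; apply; apply/mapP; exists `|j - L|%N; last by lia.
by rewrite mem_index_iota; lia.
Qed.

(** Strong induction from an index below which both sequences vanish: once the lower terms agree,
    the difference of the two limits at order [K] is that of the constant [a K - b K], and it is
    zero. *)
Lemma asymptotic0_unique f a b : asymptotic0 f a -> asymptotic0 f b -> a =1 b.
Proof.
move=> [[N aN] fa] [[M bM] fb].
pose L := Num.min N M.
have aL j : j < L -> a j = 0 by rewrite lt_min => /andP[/aN].
have bL j : j < L -> b j = 0 by rewrite lt_min => /andP[_ /bM].
suff ab n : forall i, (i < n)%N -> a (L + i%:Z) = b (L + i%:Z).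
  move=> j; have [jL|Lj] := ltP j L; first by rewrite aL ?bL.
  have -> : j = L + `|j - L|%N%:Z by lia.
  exact: (ab `|j - L|.+1%N).
elim: n => // n IHn i; rewrite ltnS leq_eqVlt => /predU1P[->|]; last exact: IHn.
set K := L + n%:Z; apply/eqP; rewrite -subr_eq0; apply/negPn/negP => c0.
have cpos : 0 < `|a K - b K| by rewrite normr_gt0.
have := cvgB (fb K) (fa K); rewrite subr0 => h.
have FF : Filter (0 : C^o)^' by exact _.
have lt_c := cvgr0_norm_lt _ (h FF) _ cpos.
have [z [/= lt_cz z0]] := filter_ex (filterI (lt_c FF) (near0_neq C)).
move: lt_cz; rewrite !fctE -mulrBl opprB addrC addrA subrK.
rewrite !sum_le_int; try by move=> j jL; rewrite ?aL ?bL ?mul0r.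
rewrite !big_ord_recr /= -/K opprD addrACA -sumrB big1 => [|m _]; last first.
  by rewrite IHn // subrr.
by rewrite add0r -mulrBl mulfK ?expfz_neq0 // ltxx.
Qed.

(** The pole has order at most two, so multiplication by [z^2] leaves only natural exponents. *)
Lemma asymptotic0_isO f a : (forall j, j < -2 -> a j = 0) ->
  (forall N, isO N (fun z => z ^+ 2 * f z - \sum_(m < N) a (m%:Z - 2) * z ^+ m)) ->
  asymptotic0 f a.
Proof.
move=> a2 fO; split; first by exists (- 2).
(* Below order [-2] all terms of the sum vanish and boundedness of [z^2 f] suffices; otherwise the
   hypothesis is applied one order beyond [N], to leave a factor [z]. *)
move=> N; apply: isO_cvg0; have [N2|N2] := ltP N (- 2).
  pose d := `|(- 2 - N)%R|%N; have d1 : (1 <= d + 0)%N by lia.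
  have NE : N = - 2 - d%:Z by lia.
  apply: isO_near_eq (isO_leq d1 (isO_mul (isO_exp C d) (fO 0))).
  near=> z; have z0 : z != 0 by near: z; exact: near0_neq.
  rewrite fsbig1 => [|j /= jN]; last by rewrite a2 ?mul0r // (le_lt_trans jN).
  rewrite big_ord0 !subr0; rewrite NE.
  have -> : - 2 - d%:Z = - (d + 2)%:Z by lia.
  by rewrite -exprnN invrK exprD; ring.
pose n := `|(N + 2)%R|%N; have NE : N = - 2 + n%:Z by rewrite /n; lia.
apply: (@isO_divXn _ n); rewrite add1n; have := fO n.+1.
apply: isO_near_eq; near=> z; have z0 : z != 0 by near: z; exact: near0_neq.
have zN : z ^ N = z ^+ n / z ^+ 2 by rewrite NE addrC expfzDr.
have zn0 : z ^+ n != 0 by rewrite expf_neq0.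
rewrite zN NE sum_le_int => [|j jL]; last by rewrite a2 ?mul0r.
have -> : \sum_(i < n.+1) a (- 2 + i%:Z) * z ^ (- 2 + i%:Z) =
    z ^- 2 * \sum_(m < n.+1) a (m%:Z - 2) * z ^+ m.
  rewrite mulr_sumr; apply: eq_bigr => m _.
  rewrite addrC; have -> : z ^ (m%:Z - 2) = z ^+ m * z ^- 2 by rewrite expfzDr.
  by ring.
by field; rewrite zn0 z0.
Unshelve. all: by end_near. Qed.
End Asymptotics.

(** * Expansion of a single conifold coefficient *)

Section ConifoldExpansion.
Variable R : realType.
Local Notation C := R[i].
Implicit Types c z : C.

Lemma csin_sqr z : (2 * csin (z / 2)) ^+ 2 =
  - ((cexp ('i * z) - 1) ^+ 2 / cexp ('i * z)).
Proof.
have -> : 'i * z = 'i * (z / 2) *+ 2 by rewrite -mulr_natr mulrA divfK ?pnatr_eq0.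
rewrite /csin cexpMn cexpN; set E := cexp _.
have E0 : E != 0 by exact: cexp_neq0.
have i0 : 'i != 0 :> C := neq0Ci _.
have -> : 2 * ((E - E^-1) / (2 * 'i)) = (E - E^-1) / 'i.
  by field; rewrite i0 E0.
by rewrite expr_div_n sqrCi; field.
Qed.

(** The coefficient of [Q^(k beta)] in [FconGV] at [t^{beta,n}]. *)
Definition con_term (k : nat) (n : int) z : C :=
  cexp ('i * (n *+ k)%:~R * z) / (k%:R * (2 * csin (k%:R * z / 2)) ^+ 2).

(** The factor of [lambda^(2g-2) e^(i n k lambda)] in the coefficient of [Q^(k beta)] in [Fcon]. *)
Definition con_weight (k g : nat) : C :=
  if g is 0 then (k%:R ^ 3)^-1 else con_coef R g / k%:R ^ (3 - 2 * g%:Z).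

Definition con_poly N (k : nat) (n : int) : {poly C} :=
  \sum_(g < N) (con_weight k g)%:P * ('X^(2 * g) * exp_poly N ('i * (n *+ k)%:~R)).

(** For [g > 0], [(2g)! = 2g (2g - 1) (2g - 2)!] and [i^(2g) = (-1)^g] turn the conifold
    coefficients into those of [w^2 e^w / (e^w - 1)^2] at [w = i k lambda]; for [g = 0],
    [B_0 = 1]. *)
Lemma con_weightE k g : (0 < k)%N ->
  con_weight k g = k%:R ^- 3 * (dbern_coef R g * ('i * k%:R) ^+ (2 * g)).
Proof.
move=> k0; have kn0 : k%:R != 0 :> C by rewrite pnatr_eq0 -lt0n.
rewrite /con_weight /dbern_coef; case: g => [|g].
  rewrite muln0 expr0 mulr1 fact0 divr1 subr0 mul1r /bernoulli /=.
  by rewrite big_ord0 subr0 divr1 rmorph1 mulr1.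
rewrite /con_coef subn1 /=.
have -> : (2 * g.+1 - 2 = 2 * g)%N by lia.
have -> : (2 * g.+1)%N = (2 * g).+2 by lia.
have -> : 3 - 2 * g.+1%:Z = 3 - (2 * g).+2%:Z by lia.
have -> : k%:R ^ (3 - (2 * g).+2%:Z) = k%:R ^+ 3 / k%:R ^+ (2 * g).+2 :> C.
  by rewrite expfzDr // -exprnN.
rewrite !factS !natrM.
have i2 : 'i ^+ (2 * g).+2 = - (-1) ^+ g :> C.
  by rewrite -addn2 exprD exprM sqrCi mulrN1.
rewrite exprMn i2.
have f0 : (2 * g)`!%:R != 0 :> C by exact: fact_neq0.
have n1 : 1 + 2 * g%:R != 0 :> C by rewrite -natrM nat1r pnatr_eq0.
have n2 : 2 + 2 * g%:R != 0 :> C by rewrite -natrM -(natrD _ 2) pnatr_eq0.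
have -> : 1 - (2 * g).+2%:R = - (2 * g).+1%:R :> C by rewrite -[(2 * g).+2]addn1 natrD; ring.
by field; rewrite f0 n1 n2 kn0 expf_neq0.
Qed.

(** By [csin_sqr], [z^2 con_term] equals [k^(-3) e^(i n k z) S(i k z)] with
    [S(w) = w^2 e^w / (e^w - 1)^2]; both factors have known truncations. *)
Lemma con_term_isO N (k : nat) n : (0 < k)%N ->
  isO N (fun z => z ^+ 2 * con_term k n z - (con_poly N k n).[z]).
Proof.
move=> k0; have kn0 : k%:R != 0 :> C by rewrite pnatr_eq0 -lt0n.
have ik0 : 'i * k%:R != 0 :> C by rewrite mulf_neq0 ?neq0Ci.
pose c : C := 'i * (n *+ k)%:~R.
pose D z := \sum_(g < N) dbern_coef R g * z ^+ (2 * g).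
pose S z := z ^+ 2 * cexp z / (cexp z - 1) ^+ 2.
have DS : isO N (fun z => D ('i * k%:R * z) - S ('i * k%:R * z)).
  exact: isO_comp_scale ik0 (dbern_even_isO R N).
have D0 : isO 0 (fun z => D ('i * k%:R * z)).
  apply: (@isO_comp_scale _ _ _ D) ik0 _; apply: isO_sum => g _.
  exact: isO_cstM (isO_leq (leq0n _) (isO_exp C (2 * g))).
have S0 : isO 0 (fun z => S ('i * k%:R * z)).
  by apply: isO_eq (isO_sub D0 (isO_leq (leq0n _) DS)) => z; rewrite subKr.
(* With [p] the truncated exponential, [S e^(c z) - p D = S (e^(c z) - p) - p (D - S)]. *)
have := isO_cstM (k%:R ^- 3) (isO_sub (isO_mull S0 (cexp_isO N c))
  (isO_mull (isO_horner (exp_poly N c)) DS)).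
apply: isO_near_eq.
have [nz _] := expm1_div R; apply: filterS (near0_scale ik0 nz) => z nz'.
have -> : (con_poly N k n).[z] = k%:R ^- 3 * ((exp_poly N c).[z] * D ('i * k%:R * z)).
  rewrite /con_poly /D horner_sum !mulr_sumr; apply: eq_bigr => g _.
  by rewrite hornerCM hornerM hornerXn con_weightE // !exprMn -/c; ring.
rewrite /con_term csin_sqr -/c /S ['i * (k%:R * z)]mulrA.
move: nz'; set E := cexp ('i * k%:R * z) => nz'.
have E0 : E != 0 by exact: cexp_neq0.
rewrite !exprMn sqrCi.
by field; rewrite kn0 E0 nz'.
Qed.

(** The Laurent coefficients of [e^(i n k lambda)], indexed by [int] to allow for shifts by
    [2 g]. *)
Definition con_exp (k : nat) (n j : int) : C :=
  if j is Posz l then ('i * (n *+ k)%:~R) ^+ l / l`!%:R else 0.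

Lemma coef_con_poly N k n m : (m < N)%N -> (con_poly N k n)`_m =
  \sum_(g < N) con_weight k g * con_exp k n (m%:Z - 2 * g%:Z).
Proof.
move=> mN; rewrite coef_sum; apply: eq_bigr => g _; rewrite coefCM coefXnM; congr (_ * _).
case: ltnP => gm.
  by have -> : m%:Z - 2 * g%:Z = Negz (2 * g - m.+1) by lia.
have -> : m%:Z - 2 * g%:Z = (m - 2 * g)%N%:Z by lia.
by rewrite coef_poly (leq_ltn_trans (leq_subr _ _) mN).
Qed.

End ConifoldExpansion.

(** * The series of [m q^m] *)

Section ArithmeticoGeometric.
Variable R : realType.
Local Notation C := R[i].
Implicit Types (q z : C) (r s : R).

Lemma cvg0_norm_le (u : nat -> C) (v : nat -> R) :
  (forall n, `|u n| <= (v n)%:C%C) -> v @ \oo --> (0 : R) ->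
  (u : nat -> C^o) @ \oo --> (0 : C^o).
Proof.
move=> uv v0; apply/cvgr0Pnorm_lt => e e0.
have eE : e = (complex.Re e)%:C%C by rewrite RRe_real // gtr0_real.
have Re0 : 0 < complex.Re e by rewrite -ltcR -eE.
near=> n; apply: le_lt_trans (uv n) _; rewrite eE ltcR.
apply: le_lt_trans (ler_norm _) _; near: n; exact: cvgr0_norm_lt v0 _ Re0.
Unshelve. all: by end_near. Qed.

Lemma natMexp_le s n : 0 <= s -> s < 1 -> n%:R * s ^+ n <= (1 - s)^-1.
Proof.
move=> s0 s1; have s1' : 0 < 1 - s by rewrite subr_gt0.
rewrite -[leRHS]div1r ler_pdivlMr //.
(* The induction needs the sharper bound [n s^n (1 - s) <= 1 - s^n], that is, [n s^n] is at most the
   sum of the [s^i] for [i < n]. *)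
apply: (@le_trans _ _ (1 - s ^+ n)); last by rewrite gerBl exprn_ge0.
elim: n => [|n IHn]; first by rewrite mul0r mul0r expr0 subrr.
rewrite -natr1 exprS; have sn0 : 0 <= s ^+ n by exact: exprn_ge0.
have sn1 : s ^+ n <= 1 by exact: exprn_ile1 s0 (ltW s1).
have h1 := ler_wpM2l s0 IHn.
have h2 : s * s ^+ n <= 1 by apply: mulr_ile1 => //; exact: ltW.
have h3 : 0 <= (1 - s) * (1 - s * s ^+ n) by rewrite mulr_ge0 ?subr_ge0 // ltW.
set p := s ^+ n in h1 h2 h3 *; set m : R := n%:R in h1 *.
have -> : (m + 1) * (s * p) * (1 - s) = s * (m * p * (1 - s)) + s * p * (1 - s) by ring.
apply: le_trans (lerD h1 (lexx _)) _; rewrite -subr_ge0.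
by have -> : 1 - s * p - (s * (1 - p) + s * p * (1 - s)) = (1 - s) * (1 - s * p) by ring.
Qed.

Lemma cvg_exp0 q : `|q| < 1 -> (fun n => q ^+ n : C^o) @ \oo --> (0 : C^o).
Proof.
move=> q1; pose r := complex.Re `|q|.
have rE : `|q| = r%:C%C by rewrite RRe_real // ger0_real.
have r0 : 0 <= r by rewrite -ler0c -rE normr_ge0.
have r1 : r < 1 by rewrite -ltcR -rE; exact: q1.
apply: (@cvg0_norm_le _ (geometric 1 r)).
  by move=> n; rewrite normrX rE /= mul1r rmorphXn.
by apply: cvg_geometric; rewrite ger0_norm.
Qed.

(** With [s] the square root of [|q|], [n |q|^n = (n s^n) s^n] is a bounded factor times a geometric
    sequence. *)
Lemma cvg_natMexp0 q : `|q| < 1 -> (fun n => n%:R * q ^+ n : C^o) @ \oo --> (0 : C^o).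
Proof.
move=> q1; pose r := complex.Re `|q|.
have rE : `|q| = r%:C%C by rewrite RRe_real // ger0_real.
have r0 : 0 <= r by rewrite -ler0c -rE normr_ge0.
have r1 : r < 1 by rewrite -ltcR -rE; exact: q1.
pose s := Num.sqrt r.
have s0 : 0 <= s by exact: sqrtr_ge0.
have rs : r = s ^+ 2 by rewrite sqr_sqrtr.
have s1 : s < 1 by rewrite -[ltRHS]sqrtr1 ltr_sqrt.
apply: (@cvg0_norm_le _ (geometric (1 - s)^-1 s)).
  move=> n; rewrite normrM normrX rE rs normr_nat /=.
  rewrite -rmorphXn -(rmorph_nat (real_complex R)) -rmorphM lecR.
  rewrite exprAC expr2 mulrA.
  by apply: ler_wpM2r; [exact: exprn_ge0 | exact: natMexp_le].
by apply: cvg_geometric; rewrite ger0_norm.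
Qed.

Lemma psum1_natMexp q n : q != 1 ->
  psum1 (fun m => m%:R * q ^+ m) n =
  (q - (1 - q) * (n%:R * q ^+ n) - q * q ^+ n) / (1 - q) ^+ 2.
Proof.
move=> q1; have q1' : 1 - q != 0 by rewrite subr_eq0 eq_sym.
rewrite /psum1; elim: n => [|[|n] IHn].
- by rewrite big_geq // mul0r mulr0 subr0 expr0 mulr1 subrr mul0r.
- by rewrite big_geq // expr1; field.
rewrite big_nat_recr //= IHn -[in RHS]natr1 [in RHS]exprS.
by field.
Qed.

Lemma cvg_psum1_natMexp q : `|q| < 1 ->
  (psum1 (fun m => m%:R * q ^+ m) : nat -> C^o) @ \oo --> (q / (1 - q) ^+ 2 : C^o).
Proof.
move=> q1; have q1' : q != 1 by apply: contraTneq q1 => ->; rewrite normr1 ltxx.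
rewrite (funext (fun n => psum1_natMexp n q1')).
have -> : q / (1 - q) ^+ 2 = (q - (1 - q) * 0 - q * 0) / (1 - q) ^+ 2.
  by rewrite !mulr0 !subr0.
apply: (@cvgM C); last exact: cvg_cst.
apply: (@cvgB C C^o); last first.
  by apply: (@cvgM C); [exact: cvg_cst | exact: cvg_exp0].
apply: (@cvgB C C^o); first exact: cvg_cst.
by apply: (@cvgM C); [exact: cvg_cst | exact: cvg_natMexp0].
Qed.

End ArithmeticoGeometric.

(** * Multiple covers *)

Section MultipleCovers.
Variables (R : realType) (H : zmodType) (X : curveClasses R H).
Local Notation C := R[i].
Implicit Types (b gamma : H) (n j : int) (lambda : C).

Lemma pairMn b n k : (b, n) *+ k = (b *+ k, n *+ k).
Proof. by elim: k => // k IHk; rewrite !mulrSr IHk. Qed.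

Definition multiple b gamma := exists2 k, (0 < k)%N & gamma = b *+ k.

(** Positive area prevents [b] from being torsion. *)
Lemma multiple_inj b k l : posCurve X b -> b *+ k = b *+ l -> k = l.
Proof.
move=> [cb b0] /(congr1 (area X)); rewrite !raddfMn /=.
by apply: mulrIn; rewrite gt_eqF // (area_gt0 cb).
Qed.

(** If [gamma = k b] then [area b <= k area b = area gamma], and classes of bounded area are finite
    in number. *)
Lemma finite_multiple gamma : finite_set (posCurve X `&` multiple^~ gamma).
Proof.
apply: sub_finite_set (finite_area_le X (area X gamma)) => b /= [[cb b0] [k k0 ->]].
split=> //; rewrite raddfMn /= -[leLHS]mulr1n ler_pMn2l // (area_gt0 cb) //.
Qed.

Lemma posNat_sum1 k0 (F : nat -> C) : (0 < k0)%N ->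
  (forall k, k != k0 -> F k = 0) -> \sum_(k \in posNat) F k = F k0.
Proof.
move=> k00 F0; rewrite -(fsbig_set1 +%R k0 F); apply/esym/fsbig_widen.
  by move=> k /= ->.
by move=> k /= [_ /eqP]; exact: F0.
Qed.

Section OneMultiple.
Variables (b gamma : H) (k : nat).
Hypotheses (bX : posCurve X b) (k0 : (0 < k)%N) (gammaE : gamma = b *+ k).

(** Hence only the [k]-th term of a sum over covers of [b] contributes to [Q^gamma]. *)
Let gamma_eq l : (gamma == b *+ l) = (l == k).
Proof.
rewrite gammaE; apply/eqP/eqP => [/(multiple_inj bX)|->] //.
Qed.

Lemma FconGV_multiple lambda n : FconGV lambda (b, n) gamma = con_term k n lambda.
Proof.
rewrite /FconGV (posNat_sum1 k0) => [|l lk]; rewrite /expQ pairMn gamma_eq /=.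
  by rewrite eqxx mul1r.
by rewrite (negbTE lk) !mul0r.
Qed.

Lemma log1subQ_multiple lambda n : log1subQ lambda (b, n) gamma =
  - (cexp ('i * (n *+ k)%:~R * lambda) / k%:R).
Proof.
rewrite /log1subQ (posNat_sum1 k0) => [|l lk]; rewrite /expQ pairMn gamma_eq /=.
  by rewrite eqxx mul1r.
by rewrite (negbTE lk) !mul0r.
Qed.

Lemma LiQ_multiple s n j :
  LiQ R s (b, n) gamma j = con_exp R k n j / k%:R ^ s.
Proof.
have expE l : expQf R ((b, n) *+ l) gamma j = (l == k)%:R * con_exp R l n j.
  by rewrite pairMn /expQf gamma_eq; case: j => // m; rewrite mulr0.
rewrite /LiQ (posNat_sum1 k0) => [|l lk]; rewrite expE ?eqxx ?mul1r //.
by rewrite (negbTE lk) !mul0r.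
Qed.

(** For [g >= N] the exponent [j + 2 - 2g] is negative, so the sum over genera may stop at [N]; the
    [Li_3] term becomes the summand [g = 0]. *)
Lemma Fcon_multiple N n j : j + 2 < N%:Z -> Fcon R (b, n) gamma j =
  \sum_(g < N) con_weight R k g * con_exp R k n (j + 2 - 2 * g%:Z).
Proof.
move=> jN; rewrite /Fcon /lamX LiQ_multiple opprK.
have con_exp0 i : i < 0 -> con_exp R k n i = 0 by case: i.
rewrite (@fsbigE _ _ _ _ _ (index_iota 1 N)); last 3 first.
- exact: iota_uniq.
- by move=> g /=; rewrite mem_index_iota => /andP[].
- move=> g g0; rewrite mem_index_iota => gN.
  by rewrite LiQ_multiple con_exp0 ?mul0r ?mulr0 //; move: g0; rewrite /posNat /=; lia.
under eq_bigl => g.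
  rewrite (_ : _ \in _ = (0 < g)%N); last by apply/idP/idP; rewrite inE.
  over.
case: N jN => [|N] jN.
  by rewrite big_ord0 con_exp0 ?mul0r ?add0r; last lia; rewrite big_geq.
rewrite -(big_mkord xpredT (fun g => con_weight R k g * con_exp R k n (j + 2 - 2 * g%:Z))).
rewrite big_ltn //= mulr0 subr0 [in RHS]mulrC; congr (_ + _).
rewrite big_nat_cond [RHS]big_nat_cond; apply: eq_big => [g|g /andP[/andP[g0 _] _]]; first lia.
rewrite LiQ_multiple /con_weight; case: g g0 => // g _.
have -> : j - (2 * g.+1%:Z - 2) = j + 2 - 2 * g.+1%:Z by lia.
by rewrite mulrA mulrAC.
Qed.

End OneMultiple.

Lemma no_multiple b gamma : ~ multiple b gamma ->
  [/\ forall lambda n, FconGV lambda (b, n) gamma = 0,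
      forall lambda n, log1subQ lambda (b, n) gamma = 0 &
      forall n j, Fcon R (b, n) gamma j = 0].
Proof.
move=> nm; have neq k : posNat k -> (gamma == b *+ k) = false.
  by move=> k0; apply/eqP => gE; apply: nm; exists k.
split=> [lambda n|lambda n|n j].
- by apply: fsbig1 => k k0; rewrite /expQ pairMn neq // !mul0r.
- by rewrite /log1subQ fsbig1 ?oppr0 // => k k0; rewrite /expQ pairMn neq // !mul0r.
have LiQ0 s i : LiQ R s (b, n) gamma i = 0.
  apply: fsbig1 => k k0; rewrite pairMn /expQf neq //.
  by case: i => m; rewrite !mul0r.
by rewrite /Fcon /lamX LiQ0 add0r fsbig1 // => g _; rewrite LiQ0 mulr0.
Qed.

(** Only finitely many [b] have [gamma] as a multiple, and each has finitely many nonzero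
    [Omega b n]. One finite range thus serves both orders of summation and every [Phi], in
    particular all values of [lambda]. *)
Lemma sheaf_sums (GV : H -> nat -> int) (Omega : H -> int -> int) gamma :
  is_sheaf_inv X GV Omega ->
  exists2 rb : seq H, (forall b, b \in rb <-> posCurve X b /\ multiple b gamma) &
  exists rn : seq int, forall Phi : H -> int -> C,
    (forall b n, ~ multiple b gamma -> Phi b n = 0) ->
    \sum_(n \in [set: int]) \sum_(b \in posCurve X) (Omega b n)%:~R * Phi b n =
      \sum_(b <- rb) \sum_(n <- rn) (Omega b n)%:~R * Phi b n /\
    \sum_(b \in posCurve X) \sum_(n \in [set: int]) (Omega b n)%:~R * Phi b n =
      \sum_(b <- rb) \sum_(n <- rn) (Omega b n)%:~R * Phi b n.
Proof.
move=> sheaf; set B := posCurve X `&` multiple^~ gamma.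
have finB : finite_set B := finite_multiple gamma.
pose U := \bigcup_(b in B) [set n | Omega b n != 0].
have finU : finite_set U.
  by apply: bigcup_finite => // b [bX _]; case: (sheaf b bX).
exists (finmap.enum_fset (fset_set B)).
  by move=> b; have -> := in_fset_set finB b; rewrite inE.
exists (finmap.enum_fset (fset_set U)) => Phi Phi0.
have sumB n : \sum_(b \in posCurve X) (Omega b n)%:~R * Phi b n =
    \sum_(b \in B) (Omega b n)%:~R * Phi b n.
  apply/esym/fsbig_widen => [b []//|b /= [bX nB]].
  by rewrite Phi0 ?mulr0 // => mb; exact: nB.
have sumU b : B b -> \sum_(n \in [set: int]) (Omega b n)%:~R * Phi b n =
    \sum_(n \in U) (Omega b n)%:~R * Phi b n.
  move=> Bb; apply/esym/fsbig_widen => // n /= [_ nU].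
  have [->|On] := eqVneq (Omega b n) 0; first by rewrite mul0r.
  by case: nU; exists b.
have -> : \sum_(b <- finmap.enum_fset (fset_set B))
    \sum_(n <- finmap.enum_fset (fset_set U)) (Omega b n)%:~R * Phi b n =
    \sum_(b \in B) \sum_(n \in U) (Omega b n)%:~R * Phi b n.
  rewrite fsbig_finite //; apply: eq_bigr => b _; by rewrite fsbig_finite.
split.
  rewrite [RHS]exchange_fsbig //.
  under [LHS]eq_fsbigr do rewrite sumB.
  apply/esym/fsbig_widen => // n /= [_ nU].
  apply: fsbig1 => b Bb; have [->|On] := eqVneq (Omega b n) 0; first by rewrite mul0r.
  by case: nU; exists b.
transitivity (\sum_(b \in B) \sum_(n \in [set: int]) (Omega b n)%:~R * Phi b n).
  apply/esym/fsbig_widen => [b []//|b /= [bX nB]].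
  by apply: fsbig1 => n _; rewrite Phi0 ?mulr0 // => mb; exact: nB.
by apply: eq_fsbigr => b; rewrite inE => /sumU.
Qed.

Lemma sheaf_inv_con_term GV Omega b k lambda : is_sheaf_inv X GV Omega ->
  posCurve X b -> (0 < k)%N -> csin (k%:R * lambda / 2) != 0 ->
  \sum_(n \in [set: int]) (Omega b n)%:~R * con_term k n lambda =
  \sum_(g \in [set: nat]) (GV b g)%:~R *
    (k%:R^-1 * (2 * csin (k%:R * lambda / 2)) ^ (2 * g%:Z - 2)).
Proof.
move=> sheaf bX k0 s0; have [_ sheaf_b] := sheaf b bX.
pose s : C := 2 * csin (k%:R * lambda / 2).
have sn0 : s != 0 by rewrite mulf_neq0 ?pnatr_eq0.
have kn0 : k%:R != 0 :> C by rewrite pnatr_eq0 -lt0n.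
(* This is [y^(1/2)] at [y = e^(i k lambda)]; then [u - 1/u = i s], and the sign of [(i s)^(2g)]
   cancels [(-1)^g]. *)
pose u := cexp ('i * (k%:R * lambda / 2)).
have uB : u - u^-1 = 'i * s.
  have i0 : 'i != 0 :> C := neq0Ci _.
  by rewrite /s /csin cexpN -/u; field; rewrite i0 cexp_neq0.
have uX n : cexp ('i * (n *+ k)%:~R * lambda) = (u ^+ 2) ^ n.
  rewrite -cexpMn -cexpMz; congr cexp.
  rewrite -mulr_natr -(mulrzr _ n) rmorphMn /= -mulr_natr.
  by field.
transitivity ((\sum_(n \in [set: int]) (Omega b n)%:~R * (u ^+ 2) ^ n) *
    (k%:R * s ^+ 2)^-1).
  rewrite mulr_fsuml; apply: eq_fsbigr => n _.
  by rewrite /con_term uX mulrA.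
rewrite sheaf_b ?cexp_neq0 // mulr_fsuml; apply: eq_fsbigr => g _.
(* At [s = 0] this would fail for [g = 1], where the left side is 1 and the right side 0. *)
have -> : s ^ (2 * g%:Z - 2) = s ^+ (2 * g) / s ^+ 2 by rewrite expfzDr.
rewrite uB exprMn [in 'i ^+ _]exprM sqrCi.
have sgn : (-1) ^+ g * (-1) ^+ g = 1 :> C by rewrite -exprMn mulrNN mulr1 expr1n.
rewrite -!mulrA; congr (_ * _); rewrite mulrA sgn mul1r.
by field; rewrite kn0 sn0.
Qed.

(** The sine has to be nonzero only for the finitely many [k] that occur for [gamma], so the
    identity applies at all small nonzero [lambda]. *)
Lemma FGV_sheaf GV Omega lambda gamma : is_sheaf_inv X GV Omega ->
  (forall b k, posCurve X b -> (0 < k)%N -> gamma = b *+ k ->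
    csin (k%:R * lambda / 2) != 0) ->
  FGV X GV lambda gamma =
  \sum_(b \in posCurve X) \sum_(n \in [set: int])
    (Omega b n)%:~R * FconGV lambda (b, n) gamma.
Proof.
move=> sheaf sin0; apply: eq_fsbigr => b; rewrite inE => bX.
have [[k k0 gE]|nm] := pselect (multiple b gamma); last first.
  rewrite [RHS]fsbig1 => [|n _]; last by have [-> _ _] := no_multiple nm; rewrite mulr0.
  apply: fsbig1 => g _; rewrite fsbig1 ?mulr0 // => k k0.
  rewrite /expQ pairMn; have [gE|] := eqVneq; last by rewrite mul0r mulr0.
  by case: nm; exists k.
under [RHS]eq_fsbigr do rewrite (FconGV_multiple bX k0 gE).
rewrite (sheaf_inv_con_term sheaf bX k0 (sin0 _ _ bX k0 gE)).
apply: eq_fsbigr => g _; congr (_ * _).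
have gl l : (gamma == b *+ l) = (l == k).
  by rewrite gE; apply/eqP/eqP => [/(multiple_inj bX)|->].
rewrite (posNat_sum1 k0) => [|l lk]; rewrite /expQ pairMn gl /=.
  by rewrite eqxx mul0rn mulr0 mul0r cexp0 !mulr1.
by rewrite (negbTE lk) mul0r mulr0.
Qed.

End MultipleCovers.

(** * Comparison of the generating functions *)

Section Conclusion.
Variables (R : realType) (H : zmodType) (X : curveClasses R H).
Local Notation C := R[i].
Implicit Types (b gamma : H) (n j : int) (lambda : C).

Lemma csin_neq0 lambda : (csin (lambda / 2) != 0) = (cexp ('i * lambda) != 1).
Proof.
have := congr1 (fun z => z != 0) (csin_sqr lambda).
rewrite /= oppr_eq0 expf_eq0 [X in _ = ~~ X]mulf_eq0 invr_eq0.
rewrite (negbTE (cexp_neq0 _)) orbF expf_eq0 /=; by rewrite mulf_eq0 pnatr_eq0 subr_eq0.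
Qed.

Lemma near0_csin_neq0 (k : nat) : (0 < k)%N ->
  \forall z \near (0 : C^o)^', csin (k%:R * z / 2) != 0.
Proof.
move=> k0; have ik0 : 'i * k%:R != 0 :> C by rewrite mulf_neq0 ?neq0Ci // pnatr_eq0 -lt0n.
have [nz _] := expm1_div R; apply: filterS (near0_scale ik0 nz) => z.
by rewrite csin_neq0 mulrA subr_eq0.
Qed.

(** [con_term_isO] compares with all of [con_poly]; its terms of degree at least [N] are then
    discarded by [horner_sub_coefs]. *)
Lemma FconGV_isO b gamma n N : posCurve X b ->
  isO N (fun z : C => z ^+ 2 * FconGV z (b, n) gamma -
    \sum_(m < N) Fcon R (b, n) gamma (m%:Z - 2) * z ^+ m).
Proof.
move=> bX; have [[k k0 gE]|nm] := pselect (multiple b gamma); last first.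
  have [F0 _ F0'] := no_multiple R nm.
  apply: isO_eq (isO_zero _ N) => z; rewrite F0 mulr0 big1 ?subrr // => m _.
  by rewrite F0' mul0r.
have h := isO_add (con_term_isO R N n k0) (horner_sub_coefs (con_poly R N k n) N).
apply: isO_eq h => z.
rewrite (FconGV_multiple bX k0 gE) addrA subrK; congr (_ - _); apply: eq_bigr => m _.
rewrite coef_con_poly // (Fcon_multiple bX k0 gE (N := N)); last by rewrite subrK ltz_nat.
by rewrite subrK.
Qed.

Lemma Fcon_lt b gamma n j : posCurve X b -> j < - 2 -> Fcon R (b, n) gamma j = 0.
Proof.
move=> bX j2; have [[k k0 gE]|nm] := pselect (multiple b gamma); last first.
  by have [_ _ ->] := no_multiple R nm.
by rewrite (Fcon_multiple bX k0 gE (N := 0)) ?big_ord0 //; lia.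
Qed.

(** For fixed [gamma], [FGV] is near the origin a finite combination of conifold coefficients, whose
    expansions are added up. *)
Lemma FGV_asymptotic GV Omega gamma : is_sheaf_inv X GV Omega ->
  asymptotic0 (fun lambda => FGV X GV lambda gamma)
    (fun j => \sum_(n \in [set: int]) \sum_(b \in posCurve X)
       (Omega b n)%:~R * Fcon R (b, n) gamma j).
Proof.
move=> sheaf; have [rb rbP [rn sums]] := sheaf_sums gamma sheaf.
have Fcon_sum j : \sum_(n \in [set: int]) \sum_(b \in posCurve X)
      (Omega b n)%:~R * Fcon R (b, n) gamma j =
    \sum_(b <- rb) \sum_(n <- rn) (Omega b n)%:~R * Fcon R (b, n) gamma j.
  apply: (sums (fun b n => Fcon R (b, n) gamma j) _).1 => b n nm.
  by have [_ _ ->] := no_multiple R nm.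
apply: asymptotic0_isO => [j j2|N].
  rewrite Fcon_sum big_seq big1 // => b /rbP[bX _].
  by rewrite big1 // => n _; rewrite (Fcon_lt _ _ bX) ?mulr0.
have FO : isO N (fun z : C => \sum_(b <- rb | b \in rb) \sum_(n <- rn) (Omega b n)%:~R *
    (z ^+ 2 * FconGV z (b, n) gamma -
     \sum_(m < N) Fcon R (b, n) gamma (m%:Z - 2) * z ^+ m)).
  apply: isO_sum => b /rbP[bX _]; apply: isO_sum => n _.
  exact/isO_cstM/FconGV_isO.
apply: isO_near_eq FO.
(* Each [b] in [rb] admits a single [k], so finitely many punctured neighbourhoods are
   intersected. *)
have sin0 : \forall z \near (0 : C^o)^', forall b, b \in rb ->
    forall k, (0 < k)%N -> gamma = b *+ k -> csin (k%:R * z / 2) != 0.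
  have : forall b, b \in rb -> posCurve X b by move=> b /rbP[].
  elim: (rb) => [_|b s IH sX]; first exact: nearW.
  have bX : posCurve X b by apply: sX; rewrite mem_head.
  have {IH} : \forall z \near (0 : C^o)^', forall c, c \in s ->
      forall k, (0 < k)%N -> gamma = c *+ k -> csin (k%:R * z / 2) != 0.
    by apply: IH => c cs; apply: sX; rewrite inE cs orbT.
  have : \forall z \near (0 : C^o)^', forall k, (0 < k)%N -> gamma = b *+ k ->
      csin (k%:R * z / 2) != 0.
    have [[k k0 gE]|nm] := pselect (multiple b gamma); last first.
      by apply: nearW => z k k0 gE; case: nm; exists k.
    apply: filterS (near0_csin_neq0 k0) => z sz l _.
    by rewrite gE => /(multiple_inj bX) <-.
  apply: filterS2 => z bz sz c; rewrite inE => /predU1P[->|/sz] //.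
apply: filterS sin0 => z sin0; rewrite -big_seq.
rewrite (FGV_sheaf sheaf) => [|b k bX k0 gE]; last first.
  by apply: (sin0 b _ k) => //; apply/rbP; split=> //; exists k.
rewrite (sums (fun b n => FconGV z (b, n) gamma) _).2 => [|b n nm]; last first.
  by have [-> _ _] := no_multiple R nm.
have -> : \sum_(m < N) (\sum_(n \in [set: int]) \sum_(b \in posCurve X)
      (Omega b n)%:~R * Fcon R (b, n) gamma (m%:Z - 2)) * z ^+ m =
    \sum_(b <- rb) \sum_(n <- rn) \sum_(m < N)
      (Omega b n)%:~R * Fcon R (b, n) gamma (m%:Z - 2) * z ^+ m.
  under eq_bigr do rewrite Fcon_sum mulr_suml.
  rewrite exchange_big; apply: eq_bigr => b _.
  under eq_bigr do rewrite mulr_suml.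
  by rewrite exchange_big.
rewrite mulr_sumr -sumrB; apply: eq_bigr => b _.
rewrite mulr_sumr -sumrB; apply: eq_bigr => n _.
rewrite mulrBr mulrCA [X in _ - X]mulr_sumr; congr (_ - _).
by apply: eq_bigr => m _; rewrite mulrA.
Qed.

(** The norm is [e^(- k Im lambda)]; this is what makes the sum of logarithms converge. *)
Lemma norm_cexp_lt1 lambda (k : nat) : 0 < complex.Im lambda -> (0 < k)%N ->
  `|cexp ('i * (k%:R * lambda))| < 1.
Proof.
move=> l0 k0; rewrite norm_cexp (_ : 1 = 1%:C%C) // ltcR expR_lt1.
rewrite -complexiE mulr_natl; case: lambda l0 => a b /= b0.
have -> : ((a +i* b)%C *+ k) = ((a *+ k) +i* (b *+ k))%C.
  by elim: (k) => // m IHm; rewrite !mulrS IHm.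
by rewrite /= mul0r mul1r sub0r oppr_lt0 pmulrn_lgt0.
Qed.

Lemma csin_neq0_Im lambda (k : nat) : 0 < complex.Im lambda -> (0 < k)%N ->
  csin (k%:R * lambda / 2) != 0.
Proof.
move=> l0 k0; rewrite csin_neq0; apply: contraTneq (norm_cexp_lt1 l0 k0) => ->.
by rewrite normr1 ltxx.
Qed.

(* [\sum_m m q^m = q / (1 - q)^2 = - (2 sin (k lambda / 2))^-2] at [q = e^(i k lambda)]. *)
Lemma cvg_psum1_log1subQ b gamma n lambda : posCurve X b -> 0 < complex.Im lambda ->
  (psum1 (fun m : nat => m%:R * log1subQ lambda (b, n + m%:Z) gamma) : nat -> C^o)
    @ \oo --> (FconGV lambda (b, n) gamma : C^o).
Proof.
move=> bX l0; have [[k k0 gE]|nm] := pselect (multiple b gamma); last first.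
  have [-> L0 _] := no_multiple R nm.
  rewrite (_ : psum1 _ = fun=> 0); first exact: cvg_cst.
  by apply/funext => M; apply: big1 => m _; rewrite L0 mulr0.
have kn0 : k%:R != 0 :> C by rewrite pnatr_eq0 -lt0n.
have q1 := norm_cexp_lt1 l0 k0; set q := cexp _ in q1.
pose c : C := - (cexp ('i * (n *+ k)%:~R * lambda) / k%:R).
rewrite (FconGV_multiple bX k0 gE).
have -> : con_term k n lambda = c * (q / (1 - q) ^+ 2).
  have qE : 1 - q != 0.
    by rewrite subr_eq0 eq_sym; apply: contraTneq q1 => ->; rewrite normr1 ltxx.
  have qE' : q - 1 != 0 by rewrite -oppr_eq0 opprB.
  have q0 : q != 0 by exact: cexp_neq0.
  rewrite /con_term csin_sqr -/q /c.
  by field; rewrite q0 kn0 qE qE'.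
(* Passing from [n] to [n + m] multiplies the coefficient by [q^m]. *)
have -> : psum1 (fun m : nat => m%:R * log1subQ lambda (b, n + m%:Z) gamma) =
    (fun M => c * psum1 (fun m => m%:R * q ^+ m) M).
  apply/funext => M; rewrite /psum1 mulr_sumr; apply: eq_bigr => m _.
  rewrite (log1subQ_multiple bX k0 gE) /c.
  have -> : 'i * ((n + m%:Z) *+ k)%:~R * lambda =
      'i * (n *+ k)%:~R * lambda + 'i * (k%:R * lambda) *+ m :> C.
    rewrite mulrnDl rmorphD /= mulrDr mulrDl; congr (_ + _).
    by rewrite -[m%:Z *+ k]mulr_natr rmorphM /= -[RHS]mulr_natr; ring.
  by rewrite cexpD cexpMn -/q; ring.
by apply: (@cvgM C); [exact: cvg_cst | exact: cvg_psum1_natMexp].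
Qed.

End Conclusion.

(** The logarithmic form is taken on the upper half-plane, where [|e^(i k lambda)| < 1] also keeps
    every sine away from 0; the conifold form holds wherever no [sin(k lambda / 2)] vanishes. *)
Theorem theorem4p1 (R : realType) (H : zmodType) (X : curveClasses R H)
    (GW : H -> nat -> rat) (GV : H -> nat -> int) (Omega : H -> int -> int)
    (GV_fin : GV_finite X GV) (GV_def : is_GV X GW GV)
    (Omega_def : is_sheaf_inv X GV Omega) :
  (* coefficients of Q^gamma lambda^j *)
  (forall (gamma : H) (j : int),
    FGW X GW gamma j =
      \sum_(n \in [set: int]) \sum_(b \in posCurve X)
        (Omega b n)%:~R * Fcon R (b, n) gamma j
    /\
    FGW X GW gamma j =
      \sum_(n \in [set: int]) \sum_(b \in posCurve X)
        (Omega b n)%:~R *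
        (lamX (- 2) (LiQ R 3 (b, n)) gamma j +
         \sum_(g \in posNat)
           (-1) ^+ (g - 1) * ratr (bernoulli (2 * g)) /
             ((2 * g)%:R * (2 * g - 2)`!%:R) *
           lamX (2 * g%:Z - 2) (LiQ R (3 - 2 * g%:Z) (b, n)) gamma j))
  /\
  (* coefficients of Q^gamma, as functions of lambda *)
  (forall (lambda : R[i]) (gamma : H), 0 < complex.Im lambda ->
    (forall (n : int) (b : H), posCurve X b ->
      summable1 (fun m : nat => m%:R * log1subQ lambda (b, n + m%:Z) gamma))
    /\
    FGV X GV lambda gamma =
      \sum_(n \in [set: int]) \sum_(b \in posCurve X)
        (Omega b n)%:~R *
        sum1 (fun m : nat => m%:R * log1subQ lambda (b, n + m%:Z) gamma))
  /\
  (forall (lambda : R[i]) (gamma : H),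
    (forall k : nat, (0 < k)%N -> csin (k%:R * lambda / 2) != 0) ->
    FGV X GV lambda gamma =
      \sum_(n \in [set: int]) \sum_(b \in posCurve X)
        (Omega b n)%:~R * FconGV lambda (b, n) gamma).
Proof.
(* Both sides are asymptotic expansions of [FGV], the left one by the definition of the
   Gopakumar-Vafa invariants. *)
have GW_eq gamma j : FGW X GW gamma j =
    \sum_(n \in [set: int]) \sum_(b \in posCurve X)
      (Omega b n)%:~R * Fcon R (b, n) gamma j.
  exact: asymptotic0_unique (GV_def gamma) (FGV_asymptotic gamma Omega_def) j.
have swap gamma (Phi : H -> int -> R[i]) :
    (forall b n, ~ multiple b gamma -> Phi b n = 0) ->
    \sum_(b \in posCurve X) \sum_(n \in [set: int]) (Omega b n)%:~R * Phi b n =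
    \sum_(n \in [set: int]) \sum_(b \in posCurve X) (Omega b n)%:~R * Phi b n.
  move=> Phi0; have [rb _ [rn sums]] := sheaf_sums gamma Omega_def.
  by have [-> ->] := sums Phi Phi0.
have FGV_eq lambda gamma :
    (forall k : nat, (0 < k)%N -> csin (k%:R * lambda / 2) != 0) ->
    FGV X GV lambda gamma =
      \sum_(n \in [set: int]) \sum_(b \in posCurve X)
        (Omega b n)%:~R * FconGV lambda (b, n) gamma.
  move=> sin0; rewrite (FGV_sheaf Omega_def) => [|b k _ k0 _]; last exact: sin0.
  apply: (swap gamma (fun b n => FconGV lambda (b, n) gamma)) => b n nm.
  by have [-> _ _] := no_multiple R nm.
(* The second equality is the first with [Fcon] and [con_coef] unfolded. *)
split; first by move=> gamma j; split; exact: GW_eq.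
split=> [lambda gamma l0|]; last exact: FGV_eq.
split=> [n b bX|]; first exact: cvgP (cvg_psum1_log1subQ bX l0).
rewrite FGV_eq => [|k k0]; last exact: csin_neq0_Im.
apply: eq_fsbigr => n _; apply: eq_fsbigr => b; rewrite inE => bX; congr (_ * _).
apply/esym/(@cvg_lim R[i]^o); first exact: norm_hausdorff.
exact: cvg_psum1_log1subQ bX l0.
Qed.
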